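(* Let $G_\phi$ be the BOT graph of a 3-CNF formula $\phi$, with $m=|E(G_\phi)|$ edges, and consider the training sample on ground set $V(G_\phi)\cup E(G_\phi)$ consisting of the $m$ sets $\{u,v,(u,v)\}$, one for each edge $(u,v)\in E(G_\phi)$. Let $K$ be any marginal kernel with log likelihood $\ell(K)$. Then there exists a marginal kernel $K'$ with $\ell(K')\le\ell(K)$ whose diagonal satisfies $K'_{ii}=\frac{\deg_{G_\phi}(u)}{m}$ for $i=u\in V(G_\phi)$ and $K'_{ii}=\frac{1}{m}$ for $i=(u,v)\in E(G_\phi)$.
   Context: A marginal kernel on a finite ground set $\mathcal{X}$ is a real symmetric matrix $K\in\mathbb{R}^{\mathcal{X}\times\mathcal{X}}$ with all eigenvalues in $[0,1]$; it defines the DPP $\mathcal{P}_K$ on subsets of $\mathcal{X}$ with $\Pr_{\boldsymbol{Y}\sim\mathcal{P}_K}[S\subseteq\boldsymbol{Y}]=\det(K_S)$ for all $S\subseteq\mathcal{X}$. For a training sample $X_1,\ldots,X_m$, $\ell(K)=-\frac1m\sum_{t=1}^m\log\Pr_{\boldsymbol{Y}\sim\mathcal{P}_K}[\boldsymbol{Y}=X_t]$ (natural log). BOT graph: let $\phi$ be a 3-CNF formula on variables $x_1,\ldots,x_n$ in which each literal occurs in at most $k$ clauses, and let $H$ be a $d$-regular graph whose vertices are identified with the $2kn$ literal copies below. An equality gadget between two nodes $x,y$ adds two new nodes $u,v$ and edges $xu,xv,yu,yv,uv$. $G_\phi$ is built as follows: (1) for each $i\in[n]$, $j\in[k]$ create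 literal nodes $x_i^{(j)}$ and $\bar x_i^{(j)}$; (2) for each literal node create a block of three nodes $T,F,D$ forming a triangle; (3) join $x_i^{(j)}$ to $\bar x_i^{(j)}$, and join each literal node to the $D$ node of its own block; (4) for each literal, connect every pair of its $k$ copies by an equality gadget; (5) for each clause $(\ell_a\vee\ell_b\vee\ell_c)$ choose copies of the three literals (each literal copy used in at most one clause), let $T_a,T_b,T_c$ be the $T$ nodes of their blocks, and add six new nodes $u_s,v_s$ ($s\in\{a,b,c\}$) with edges $\ell_su_s$, $T_su_s$, $u_sv_s$ and the triangle $v_av_bv_c$; (6) for each edge of $H$ between two literal blocks, connect their $T$ nodes, their $F$ nodes and their $D$ nodes, each pair by an equality gadget. *)

(* Defs.v *)
From HB Require Import structures.
From mathcomp Require Import all_boot all_order all_algebra.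
From mathcomp Require Import boolp classical_sets reals constructive_ereal ereal exp.

Set Implicit Arguments.
Unset Strict Implicit.
Unset Printing Implicit Defensive.

Import Order.TTheory GRing.Theory Num.Theory.
Local Open Scope ring_scope.

Record sgraph (V : finType) := SGraph {
  adj :> rel V;
  adj_sym : symmetric adj;
  adj_irrefl : irreflexive adj }.

Section Graph.
Context (V : finType) (G : sgraph V).

Definition deg (v : V) : nat := #|[set w | G v w]|.

Definition regular (d : nat) : Prop := forall v, deg v = d.

Definition is_edge (e : {set V}) : bool :=
  [exists u, exists v, G u v && (e == [set u; v])].

Definition edge : finType := {e : {set V} | is_edge e}.

Definition ground : finType := (V + edge)%type.

(** For an edge e = (u, v), the subset {u, v, e} of the ground set. *)
Definition edge_set (e : edge) : {set ground} :=
  [set x : ground | match x with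
                    | inl w => w \in val e
                    | inr e' => e' == e
                    end].

Definition edge_sample : seq {set ground} := [seq edge_set e | e <- enum edge].

End Graph.

Section DPP.
Context (R : realType) (X : finType).

(** Rows and columns are indexed by X through [enum_rank]. *)
Definition kernel : Type := 'M[R]_#|X|.

Definition entry (K : kernel) (x y : X) : R := K (enum_rank x) (enum_rank y).

(** A real symmetric matrix has only real eigenvalues, so quantifying over R
    covers the whole spectrum. *)
Definition marginal_kernel (K : kernel) : Prop :=
  K^T = K /\ forall a : R, eigenvalue K a -> 0 <= a <= 1.

Definition principal_submx (K : kernel) (S : {set X}) : 'M[R]_#|S| :=
  \matrix_(i, j) entry K (enum_val i) (enum_val j).

Definition is_distr (P : {ffun {set X} -> R}) : Prop :=
  (forall Y, 0 <= P Y) /\ \sum_Y P Y = 1.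

Definition is_dpp (K : kernel) (P : {ffun {set X} -> R}) : Prop :=
  is_distr P /\
  forall S : {set X}, \sum_(Y : {set X} | S \subset Y) P Y =
                      \det (principal_submx K S).

(** There is at most one such distribution ([is_dpp_uniq] below); it exists
    whenever K is a marginal kernel. *)
Definition dpp (K : kernel) : {ffun {set X} -> R} :=
  xget [ffun=> 0] (fun P => is_dpp K P).

(** Extended-real valued: the loss is +oo as soon as some sample set has
    probability 0 ([lne] is the natural logarithm with [lne 0 = -oo]). *)
Definition loss (s : seq {set X}) (K : kernel) : \bar R :=
  (- (((size s)%:R^-1)%:E * \sum_(A <- s) lne (dpp K A)%:E))%E.

Lemma is_dpp_uniq (K : kernel) (P Q : {ffun {set X} -> R}) :
  is_dpp K P -> is_dpp K Q -> P = Q.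
Proof.
move=> [_ HP] [_ HQ]; apply/ffunP => S.
have [m] := ubnP #|~: S|; elim: m S => // m IH S leSm.
have := etrans (HP S) (esym (HQ S)).
rewrite (bigD1 S) //= [in RHS](bigD1 S) //=.
suff -> : \sum_(Y : {set X} | (S \subset Y) && (Y != S)) P Y =
          \sum_(Y : {set X} | (S \subset Y) && (Y != S)) Q Y by move/addIr.
apply: eq_bigr => Y /andP[SY nYS]; apply: IH.
have : ~: Y \proper ~: S by rewrite properE !finset.setCS -properE finset.properEneq
  eq_sym nYS.
by move=> /proper_card /leq_trans; apply; rewrite -ltnS.
Qed.

Lemma dppE (K : kernel) (P : {ffun {set X} -> R}) : is_dpp K P -> dpp K = P.
Proof.
by move=> HP; rewrite /dpp; case: xgetP => [Q _ HQ|/(_ P)//]; apply: is_dpp_uniq HP.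
Qed.

End DPP.

(** [(i, true)] is the literal x_i and [(i, false)] its negation. *)
Definition literal (n : nat) : finType := ('I_n * bool)%type.

Definition clause (n : nat) : Type := 3.-tuple (literal n).

Definition cnf3 (n M : nat) : Type := M.-tuple (clause n).

Definition occurs_at_most n M (k : nat) (phi : cnf3 n M) : Prop :=
  forall l : literal n, (#|[set c : 'I_M | l \in tnth phi c]| <= k)%N.

(** The k copies of each literal: [(l, j)] is the j-th copy of l. *)
Definition litcopy (n k : nat) : finType := (literal n * 'I_k)%type.

(** A choice, for the s-th literal of the clause c, of one of its copies. *)
Definition chosen n M k (phi : cnf3 n M) (sigma : 'I_M -> 'I_3 -> 'I_k)
    (c : 'I_M) (s : 'I_3) : litcopy n k :=
  (tnth (tnth phi c) s, sigma c s).

Definition valid_choice n M k (phi : cnf3 n M) (sigma : 'I_M -> 'I_3 -> 'I_k)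
    : Prop :=
  forall c s c' s', chosen phi sigma c s = chosen phi sigma c' s' -> c = c'.

(** Labels T, F, D of the nodes of a block. *)
Definition label : finType := option bool.
Definition lT : label := Some true.
Definition lF : label := Some false.
Definition lD : label := None.

(** The two nodes u, v of an equality gadget, and u_s, v_s in a clause. *)
Definition nu : bool := true.
Definition nv : bool := false.

Definition copypair (k : nat) : finType := {p : {set 'I_k} | #|p| == 2}.

Section BOT.
Context (n M k : nat) (phi : cnf3 n M) (sigma : 'I_M -> 'I_3 -> 'I_k).
Context (H : sgraph (litcopy n k)).

Inductive bot_vertex : Type :=
| Lit of litcopy n k
| Blk of litcopy n k & label
| CopyEq of literal n & copypair k & bool
| Cls of 'I_M & 'I_3 & bool
| HEq of edge H & label & bool.

Let code : finType :=
  (litcopy n k + litcopy n k * label + literal n * copypair k * bool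
   + 'I_M * 'I_3 * bool + edge H * label * bool)%type.

Let encode (x : bot_vertex) : code :=
  match x with
  | Lit a => inl (inl (inl (inl a)))
  | Blk a t => inl (inl (inl (inr (a, t))))
  | CopyEq l p b => inl (inl (inr (l, p, b)))
  | Cls c s b => inl (inr (c, s, b))
  | HEq e t b => inr (e, t, b)
  end.

Let decode (x : code) : bot_vertex :=
  match x with
  | inl (inl (inl (inl a))) => Lit a
  | inl (inl (inl (inr (a, t)))) => Blk a t
  | inl (inl (inr (l, p, b))) => CopyEq l p b
  | inl (inr (c, s, b)) => Cls c s b
  | inr (e, t, b) => HEq e t b
  end.

Let encodeK : cancel encode decode. Proof. by case. Qed.

HB.instance Definition _ := Equality.copy bot_vertex (can_type encodeK).
HB.instance Definition _ := Choice.copy bot_vertex (can_type encodeK).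
HB.instance Definition _ := Countable.copy bot_vertex (can_type encodeK).
HB.instance Definition _ := Finite.copy bot_vertex (can_type encodeK).

(** Every edge is listed in at least one direction; [bot_graph] takes the
    symmetric closure. *)
Definition bot_arc (x y : bot_vertex) : bool :=
  match x, y with
  | Lit ((i, b), j), Lit ((i', b'), j') => [&& i == i', j == j' & b != b']
  | Blk a t, Blk a' t' => (a == a') && (t != t')
  | Lit a, Blk a' t => (a == a') && (t == lD)
  | Lit (l, j), CopyEq l' p _ => (l == l') && (j \in val p)
  | CopyEq l p b, CopyEq l' p' b' => [&& l == l', p == p' & b != b']
  | Lit a, Cls c s b => (a == chosen phi sigma c s) && (b == nu)
  | Blk a t, Cls c s b => [&& a == chosen phi sigma c s, t == lT & b == nu]
  | Cls c s b, Cls c' s' b' =>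
      (c == c') && (((s == s') && (b != b'))
                    || [&& s != s', b == nv & b' == nv])
  | Blk a t, HEq e t' _ => (a \in val e) && (t == t')
  | HEq e t b, HEq e' t' b' => [&& e == e', t == t' & b != b']
  | _, _ => false
  end.

Definition bot_adj : rel bot_vertex := [rel x y | bot_arc x y || bot_arc y x].

Lemma bot_adj_sym : symmetric bot_adj.
Proof. by move=> x y; rewrite /bot_adj /= orbC. Qed.

Lemma bot_adj_irrefl : irreflexive bot_adj.
Proof.
by move=> [[[i b] j]|a t|l p b|c s b|e t b]; rewrite /bot_adj /= !eqxx ?andbF.
Qed.

Definition bot_graph : sgraph bot_vertex := SGraph bot_adj_sym bot_adj_irrefl.

End BOT.

(* Main.v *)
(** The likelihood depends continuously on the marginal kernel and marginal
    kernels form a compact set, so a maximum likelihood kernel K' exists.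
    Rescaling the x-th row and column of the L-ensemble of K' by t > 0
    ("tilting") gives a marginal kernel again; it multiplies the probability of
    each set containing x by t^2 and divides all probabilities by
    1 + (t^2 - 1) K'_xx. Writing c for the number of sample sets that contain x
    and m for the sample size, maximality reads s^c <= (1 + (s - 1) K'_xx)^m for
    all s > 0, with equality at s = 1; comparing derivatives there gives
    K'_xx = c / m. In the edge sample of a graph, c is the degree for a vertex
    and 1 for an edge.

    All probabilities are handled through the formula
    P(Y) = det (1_Y K + (1 - 1_Y) (1 - K)), which makes sense also when 1 is an
    eigenvalue of K and no L-ensemble exists. *)
Require Import Defs.
From mathcomp Require Import all_boot all_order all_algebra.
From mathcomp Require Import ring lra.
From mathcomp Require Import boolp classical_sets reals constructive_ereal.
From mathcomp Require Import ereal topology normedtype derive sequences exp.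

Set Implicit Arguments.
Unset Strict Implicit.
Unset Printing Implicit Defensive.

Import Order.TTheory GRing.Theory Num.Theory.
Import numFieldNormedType.Exports.
Local Open Scope ring_scope.

(** * Positive semidefinite quadratic forms and the order interval between 0 and 1 *)

Section PositiveForms.
Context (R : realType) (n : nat).
Implicit Types (K A : 'M[R]_n) (u v w : 'rV[R]_n).

Definition bform K u v : R := (u *m K *m v^T) 0 0.

Definition psd K : Prop := K^T = K /\ forall v, 0 <= bform K v v.

(** The condition that the spectrum lies in [0, 1], in terms of quadratic forms: a family of closed
    inequalities, suited to compactness and to tilting. *)
Definition psd_contraction K : Prop := psd K /\ psd (1%:M - K).

Lemma bformDl K u v w : bform K (u + v) w = bform K u w + bform K v w.
Proof. by rewrite /bform !mulmxDl mxE. Qed.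

Lemma bformDr K u v w : bform K w (u + v) = bform K w u + bform K w v.
Proof. by rewrite /bform linearD mulmxDr mxE. Qed.

Lemma bformZl K a u v : bform K (a *: u) v = a * bform K u v.
Proof. by rewrite /bform -!scalemxAl mxE. Qed.

Lemma bformZr K a u v : bform K u (a *: v) = a * bform K u v.
Proof. by rewrite /bform linearZ -scalemxAr mxE. Qed.

Lemma bformNl K u v : bform K (- u) v = - bform K u v.
Proof. by rewrite -scaleN1r bformZl mulN1r. Qed.

Lemma bformNr K u v : bform K u (- v) = - bform K u v.
Proof. by rewrite -scaleN1r bformZr mulN1r. Qed.

Lemma bformBm K A u v : bform (K - A) u v = bform K u v - bform A u v.
Proof. by rewrite /bform mulmxBr mulmxBl !mxE. Qed.

Lemma bform_scalar a u v : bform a%:M u v = a * bform 1%:M u v.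
Proof. by rewrite /bform mul_mx_scalar mulmx1 -scalemxAl mxE. Qed.

Lemma bformC K u v : K^T = K -> bform K u v = bform K v u.
Proof.
move=> sK; rewrite /bform; have -> : u *m K *m v^T = (v *m K *m u^T)^T.
  by rewrite !trmx_mul trmxK sK mulmxA.
by rewrite mxE.
Qed.

Lemma bformE K u v : bform K u v = \sum_j (\sum_i u 0 i * K i j) * v 0 j.
Proof. by rewrite /bform mxE; apply: eq_bigr => j _; rewrite !mxE. Qed.

Lemma bform_delta K i j : bform K (delta_mx 0 i) (delta_mx 0 j) = K i j.
Proof.
rewrite /bform -rowE trmx_delta -colE !mxE //.
Qed.

Lemma bform1E u : bform 1%:M u u = \sum_i u 0 i ^+ 2.
Proof.
by rewrite /bform mulmx1 mxE; apply: eq_bigr => i _; rewrite mxE expr2.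
Qed.

Lemma bform1_ge0 u : 0 <= bform 1%:M u u.
Proof. by rewrite bform1E sumr_ge0 // => i _; rewrite sqr_ge0. Qed.

Lemma bform1_eq0 u : bform 1%:M u u = 0 -> u = 0.
Proof.
rewrite bform1E => /eqP; rewrite psumr_eq0; last by move=> i _; rewrite sqr_ge0.
move=> /allP u0; apply/rowP => i; rewrite mxE.
by have := u0 i (mem_index_enum _); rewrite /= sqrf_eq0 => /eqP.
Qed.

Lemma bform1_gt0 u : u != 0 -> 0 < bform 1%:M u u.
Proof.
move=> u0; rewrite lt_neqAle bform1_ge0 andbT.
by apply: contraNneq u0 => /esym/bform1_eq0 ->.
Qed.

(** The form at [u + x *: v] is a quadratic polynomial in [x] that is nonnegative everywhere. *)
Lemma psd_cauchy_schwarz K u v : psd K ->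
  bform K u v ^+ 2 <= bform K u u * bform K v v.
Proof.
move=> [sK pK]; set a := bform K u u; set b := bform K u v; set c := bform K v v.
have pol x : 0 <= a + 2 * x * b + x ^+ 2 * c.
  have := pK (u + x *: v).
  rewrite bformDl !bformDr !bformZl !bformZr (bformC v u sK) -/a -/b -/c; lra.
have a0 : 0 <= a by apply: pK.
have [c0|c0] := eqVneq c 0.
  suff -> : b = 0 by rewrite expr0n /= mulr_ge0 ?c0.
  (* With [c = 0] the polynomial is affine in [x]; this point gives it the value -1. *)
  apply/eqP/negPn/negP => b0; have := pol (- (a + 1) / (2 * b)).
  have -> : 2 * (- (a + 1) / (2 * b)) * b = - (a + 1) by field.
  by rewrite c0; lra.
have cp : 0 < c by rewrite lt_neqAle eq_sym c0 pK.
(* The minimiser of the quadratic polynomial. *)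
have := pol (- b / c).
have -> : a + 2 * (- b / c) * b + (- b / c) ^+ 2 * c = (a * c - b ^+ 2) / c.
  by field.
by rewrite pmulr_lge0 ?invr_gt0// subr_ge0.
Qed.

(** Cauchy-Schwarz for [v] and [v *m K], whose pairing under [K] is the squared norm of [v *m K]. *)
Lemma psd_kernel K v : psd K -> bform K v v = 0 -> v *m K = 0.
Proof.
move=> pK v0; apply: bform1_eq0.
have -> : bform 1%:M (v *m K) (v *m K) = bform K v (v *m K).
  by rewrite /bform mulmx1.
apply/eqP; rewrite -sqrf_eq0 eq_le sqr_ge0 andbT.
by have := psd_cauchy_schwarz v (v *m K) pK; rewrite v0 mul0r.
Qed.

Lemma psd_eigenvalue_ge0 K a : psd K -> eigenvalue K a -> 0 <= a.
Proof.
move=> [_ pK] /eigenvalueP[v vK v0].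
have : 0 <= a * bform 1%:M v v by rewrite -bformZl /bform mulmx1 -vK; apply: pK.
by rewrite pmulr_lge0// bform1_gt0.
Qed.

Lemma psd_entry_sqr K i j : psd K -> K i j ^+ 2 <= K i i * K j j.
Proof.
by move=> /(psd_cauchy_schwarz (delta_mx 0 i) (delta_mx 0 j)); rewrite !bform_delta.
Qed.

Lemma psd_diag_ge0 K i : psd K -> 0 <= K i i.
Proof. by move=> [_ /(_ (delta_mx 0 i))]; rewrite bform_delta. Qed.

Lemma contraction_opp K : psd_contraction K -> psd_contraction (1%:M - K).
Proof. by case=> pK qK; split => //; rewrite opprB addrC subrK. Qed.

Lemma contraction_diag K i : psd_contraction K -> 0 <= K i i <= 1.
Proof.
case=> /(@psd_diag_ge0 _ i) -> /(@psd_diag_ge0 _ i).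
by rewrite !mxE eqxx /= subr_ge0.
Qed.

Lemma contraction_norm_entry K i j : psd_contraction K -> `|K i j| <= 1.
Proof.
move=> cK; have /andP[i0 i1] := contraction_diag i cK.
have /andP[j0 j1] := contraction_diag j cK.
rewrite -(@ler_pXn2r _ 2) ?nnegrE// expr1n real_normK ?num_real//.
by apply: le_trans (psd_entry_sqr i j cK.1) _; rewrite mulr_ile1.
Qed.

End PositiveForms.

(** * Continuity of quadratic forms and determinants in the matrix entries *)

Section Continuity.
Context (R : realType) (T : topologicalType) (n : nat).
Implicit Types f : T -> 'M[R]_n.

Lemma continuous_sumr (I : Type) (r : seq I) (P : pred I) (F : I -> T -> R) :
  (forall i, P i -> continuous (F i)) ->
  continuous (fun x => \sum_(i <- r | P i) F i x).
Proof. by move=> cF; apply: continuous_big => //; apply: add_continuous. Qed.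

Lemma continuous_prodr (I : Type) (r : seq I) (P : pred I) (F : I -> T -> R) :
  (forall i, P i -> continuous (F i)) ->
  continuous (fun x => \prod_(i <- r | P i) F i x).
Proof. by move=> cF; apply: continuous_big => //; apply: mul_continuous. Qed.

Lemma continuous_bform f (u v : T -> 'rV[R]_n) :
  (forall i j, continuous (fun x => f x i j)) ->
  (forall i, continuous (fun x => u x 0 i)) ->
  (forall i, continuous (fun x => v x 0 i)) ->
  continuous (fun x => bform (f x) (u x) (v x)).
Proof.
move=> cf cu cv; under eq_fun do rewrite bformE.
apply: continuous_sumr => j _ x; apply: cvgM; last exact: cv.
by move: x; apply: continuous_sumr => i _ x; apply: cvgM; [exact: cu|exact: cf].
Qed.

Lemma continuous_det f : (forall i j, continuous (fun x => f x i j)) ->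
  continuous (fun x => \det (f x)).
Proof.
move=> cf; rewrite /determinant; apply: continuous_sumr => s _ x.
apply: cvgM; first exact: cvg_cst.
by move: x; apply: continuous_prodr => i _.
Qed.

End Continuity.

(** * Rayleigh quotients: from eigenvalue bounds to quadratic forms and back *)

Section Rayleigh.
Context (R : realType) (n : nat).
Implicit Types (K : 'M[R]_n) (v : 'rV[R]_n).
Local Open Scope classical_set_scope.

Lemma bounded_set_entries m (A : set 'rV[R]_m) :
  (forall v : 'rV[R]_m, A v -> forall i, `|v 0 i| <= 1) -> bounded_set A.
Proof.
move=> A1; exists 1; split=> // M M1 v Av /=.
rewrite /Num.norm/= mx_normrE; apply/bigmax_leP; split; first lra.
by case=> i j _ /=; rewrite ord1 (le_trans (A1 _ Av j)) // ltW.
Qed.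

Lemma compact_sphere : compact [set v : 'rV[R]_n | bform 1%:M v v = 1].
Proof.
apply: bounded_closed_compact.
  apply: bounded_set_entries => v /= v1 i.
  rewrite -(@ler_pXn2r _ 2) ?nnegrE// expr1n real_normK ?num_real// -v1 bform1E.
  by rewrite (bigD1 i)//= lerDl sumr_ge0// => j _; rewrite sqr_ge0.
apply: (@preimage_closed _ _ (fun v : 'rV[R]_n => bform 1%:M v v) [set 1%R]);
  last exact: closed_eq.
move=> v _; move: v; apply: continuous_bform => [i j|i|i].
- exact: cst_continuous.
- exact: coord_continuous.
- exact: coord_continuous.
Qed.

(* The minimum of the Rayleigh quotient is an eigenvalue: at a minimiser the
   semidefinite form K - min vanishes, so the minimiser lies in its kernel. *)
Lemma psd_of_eigenvalues K :
  K^T = K -> (forall a, eigenvalue K a -> 0 <= a) -> psd K.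
Proof.
move=> sK eK; split=> // v.
have [->|v0] := eqVneq v 0; first by rewrite /bform mul0mx mul0mx mxE.
pose nrm u := (Num.sqrt (bform (1%:M : 'M[R]_n) u u))^-1 *: u.
have nrmK u : u != 0 -> bform 1%:M (nrm u) (nrm u) = 1.
  move=> /bform1_gt0 u0; rewrite bformZl bformZr mulrA -expr2 exprVn sqr_sqrtr ?ltW//.
  by rewrite mulVf// gt_eqF.
have [] := @EVT_min_rV R n (fun u => bform K u u) _ _ compact_sphere.
- by exists (nrm v); apply: nrmK.
- apply: continuous_subspaceT; apply: continuous_bform => [i j|i|i].
  + exact: cst_continuous.
  + exact: coord_continuous.
  + exact: coord_continuous.
move=> w; rewrite inE /= => w1 wmin; set a := bform K w w in wmin.
(* By homogeneity, the minimum over the unit sphere bounds the form on all vectors. *)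
have Ka u : a * bform 1%:M u u <= bform K u u.
  have [->|u0] := eqVneq u 0; first by rewrite /bform !mul0mx mxE mulr0.
  have := wmin (nrm u); rewrite inE /= => /(_ (nrmK _ u0)).
  rewrite bformZl bformZr mulrA -expr2 exprVn sqr_sqrtr ?bform1_ge0//.
  by rewrite mulrC ler_pdivlMr ?bform1_gt0.
have pKa : psd (K - a%:M).
  split; first by rewrite linearB /= tr_scalar_mx sK.
  by move=> u; rewrite bformBm bform_scalar subr_ge0.
have : w *m (K - a%:M) = 0.
  by apply: psd_kernel => //; rewrite bformBm bform_scalar w1 mulr1 subrr.
rewrite mulmxBr mul_mx_scalar => /eqP; rewrite subr_eq0 => /eqP wK.
have a0 : 0 <= a.
  apply: eK; apply/eigenvalueP; exists w => //.
  by apply: contra_eq_neq w1 => ->; rewrite /bform !mul0mx mxE eq_sym oner_eq0.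
by apply: le_trans (Ka v); rewrite mulr_ge0 ?bform1_ge0.
Qed.

Lemma eigenvalue_opp1 K a : eigenvalue (1%:M - K) a -> eigenvalue K (1 - a).
Proof.
move=> /eigenvalueP[v vK v0]; apply/eigenvalueP; exists v => //.
by rewrite scalerBl scale1r -vK mulmxBr mulmx1 opprB addrC subrK.
Qed.

Lemma contraction_of_eigenvalues K :
  K^T = K -> (forall a, eigenvalue K a -> 0 <= a <= 1) -> psd_contraction K.
Proof.
move=> sK eK; split; apply: psd_of_eigenvalues => //.
- by move=> a /eK/andP[].
- by rewrite linearB /= tr_scalar_mx sK.
- by move=> a /eigenvalue_opp1/eK; lra.
Qed.

Lemma contraction_eigenvalue K a :
  psd_contraction K -> eigenvalue K a -> 0 <= a <= 1.
Proof.
move=> [pK qK] eK; rewrite (psd_eigenvalue_ge0 pK eK) /= -subr_ge0.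
apply: (psd_eigenvalue_ge0 qK); apply: eigenvalue_opp1.
by rewrite opprB addrC subrK.
Qed.

End Rayleigh.

(** * Determinant identities *)

Section Determinants.

(** Sylvester's identity: one block matrix is factored into block triangular matrices in two
    ways. *)
Lemma det_add1_mulC (R : comPzRingType) m n (A : 'M[R]_(m, n)) (B : 'M[R]_(n, m)) :
  \det (1%:M + A *m B) = \det (1%:M + B *m A).
Proof.
have E1 : block_mx 1%:M (- A) B 1%:M =
    block_mx (1%:M + A *m B) (- A) 0 1%:M *m block_mx 1%:M 0 B 1%:M.
  rewrite mulmx_block !(mulmx1, mul1mx, mulmx0, mul0mx, add0r, addr0).
  by rewrite mulNmx addrK.
have E2 : block_mx 1%:M (- A) B 1%:M =
    block_mx 1%:M 0 B 1%:M *m block_mx 1%:M (- A) 0 (1%:M + B *m A).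
  rewrite mulmx_block !(mulmx1, mul1mx, mulmx0, mul0mx, add0r, addr0).
  by rewrite mulmxN addrC addrK.
have := congr1 determinant (etrans (esym E1) E2).
by rewrite !det_mulmx !det_ublock !det_lblock !det1 !mulr1 !mul1r.
Qed.

(** Multilinearity in all rows at once: each product of the Leibniz formula for [A + B] is
    distributed over the choices of [A] or [B] in each row. *)
Lemma sum_det_rows (R : comPzRingType) n (A B : 'M[R]_n) :
  \sum_(Y : {set 'I_n}) \det (\matrix_(i, j) if i \in Y then A i j else B i j) =
  \det (A + B).
Proof.
rewrite [RHS]/determinant.
under [RHS]eq_bigr => s _.
  under eq_bigr do rewrite mxE.
  rewrite bigA_distr big_distrr /=; over.
rewrite exchange_big /=; apply: eq_bigr => Y _.
by apply: eq_bigr => s _; congr (_ * _); apply: eq_bigr => i _; rewrite mxE.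
Qed.

Lemma det_zero_row (R : comPzRingType) n (A : 'M[R]_n) i :
  (forall j, A i j = 0) -> \det A = 0.
Proof.
by move=> A0; rewrite (expand_det_row A i) big1 // => j _; rewrite A0 mul0r.
Qed.

End Determinants.

(** * Set probabilities as determinants: inclusion sums and nonnegativity *)

Section DppMatrix.
Context (R : realType) (n : nat).
Implicit Types (K : 'M[R]_n) (Y S : {set 'I_n}).

(* The row-wise mixture of K (rows in Y) and 1 - K (rows outside Y): its
   determinant is the probability of Y under the DPP with kernel K. *)
Definition dpp_mx K Y : 'M[R]_n :=
  \matrix_(i, j) if i \in Y then K i j else (1%:M - K) i j.

(** Zeroing the rows of [1 - K] in [S] kills every [Y] that does not contain [S]; the remaining rows
    add up to [K + (1 - K) = 1]. *)
Lemma sum_det_dpp_mx K S :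
  \sum_(Y : {set 'I_n} | S \subset Y) \det (dpp_mx K Y) =
  \det (\matrix_(i, j) (if i \in S then K i j else (1%:M : 'M[R]_n) i j)).
Proof.
pose B : 'M[R]_n := \matrix_(i, j) if i \in S then 0 else (1%:M - K) i j.
have -> : (\matrix_(i, j) (if i \in S then K i j else (1%:M : 'M[R]_n) i j)) = K + B.
  apply/matrixP => i j; rewrite !mxE; case: ifP => _; rewrite ?addr0//.
  by rewrite addrC subrK.
rewrite -sum_det_rows big_mkcond /=; apply: eq_bigr => Y _.
case: ifPn => [SY|/subsetPn[i iS iY]].
  congr (\det _); apply/matrixP => i j; rewrite !mxE; case: ifPn => // iY.
  by case: ifPn => // /(fintype.subsetP SY); rewrite (negbTE iY).
by rewrite (@det_zero_row _ _ _ i) // => j; rewrite !mxE (negbTE iY) iS.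
Qed.

(** With [W] selecting the rows in [S], the left matrix is [1 + W^T W (K - 1)]; Sylvester's identity
    turns it into [1 + W (K - 1) W^T], the principal submatrix. *)
Lemma det_rows_principal K m (f : 'I_m -> 'I_n) S :
  injective f -> (forall i, (i \in S) = (i \in codom f)) ->
  \det (\matrix_(i, j) (if i \in S then K i j else (1%:M : 'M[R]_n) i j)) =
  \det (\matrix_(i, j) K (f i) (f j)).
Proof.
move=> f_inj fS; pose W : 'M[R]_(m, n) := \matrix_(i, j) (f i == j)%:R.
have WE p (A : 'M[R]_(n, p)) i j : (W *m A) i j = A (f i) j.
  rewrite mxE (bigD1 (f i)) //= mxE eqxx mul1r big1 ?addr0// => k kf.
  by rewrite mxE eq_sym (negbTE kf) mul0r.
have -> : \matrix_(i, j) (if i \in S then K i j else (1%:M : 'M[R]_n) i j) =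
    1%:M + W^T *m (W *m (K - 1%:M)).
  apply/matrixP => i j; rewrite mxE [RHS]mxE [(W^T *m _) i j]mxE.
  under [X in _ = _ + X]eq_bigr do rewrite WE mxE mxE.
  rewrite fS; case: ifPn => [/codomP[k ->]|niS].
    rewrite (bigD1 k) //= eqxx mul1r big1 ?addr0.
      by rewrite !mxE [RHS]addrC subrK.
    by move=> l lk; rewrite (inj_eq f_inj) (negbTE lk) mul0r.
  rewrite big1 ?addr0// => k _; rewrite (_ : f k == i = false) ?mul0r//.
  by apply: contraNF niS => /eqP <-; apply: codom_f.
rewrite det_add1_mulC; congr (\det _); apply/matrixP => i j.
rewrite mxE -mulmxA WE [(_ *m W^T) _ _]mxE.
under eq_bigr do rewrite mxE [W^T _ _]mxE [W _ _]mxE.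
rewrite (bigD1 (f j)) //= eqxx mulr1 big1 ?addr0; last first.
  by move=> k kf; rewrite eq_sym (negbTE kf) mulr0.
by rewrite !mxE (inj_eq f_inj) [LHS]addrC subrK.
Qed.

(* K (1 - K) = K (1 - K) K + (1 - K) K (1 - K) *)
Lemma strict_contraction_sqr K v :
  K^T = K -> (forall u : 'rV[R]_n, u != 0 -> 0 < bform K u u < bform 1%:M u u) ->
  bform 1%:M (v *m K) (v *m K) = bform K v v -> v = 0.
Proof.
move=> sK pK vK; set w := v *m K in vK.
have cw u : bform K v u = bform 1%:M w u by rewrite /bform mulmx1.
(* The sum expands to [v K v^T - w w^T], zero by hypothesis; each summand is positive unless its
   vector vanishes. *)
have q1 : bform (1%:M - K) w w + bform K (v - w) (v - w) = 0.
  rewrite bformBm !bformDl !bformDr !bformNl !bformNr opprK.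
  by rewrite (bformC w v sK) !cw; rewrite cw in vK; lra.
have K0 u : 0 <= bform K u u <= bform 1%:M u u.
  have [->|/pK] := eqVneq u 0; first by rewrite /bform !mul0mx mxE lexx.
  by move=> /andP[/ltW -> /ltW].
have [w0|w0] := eqVneq w 0.
  have [vw0|vw0] := eqVneq (v - w) 0; first by move: vw0; rewrite w0 subr0.
  by exfalso; move: (pK _ vw0) (K0 w) q1; rewrite bformBm; clear; lra.
by exfalso; move: (pK _ w0) (K0 (v - w)) q1; rewrite bformBm; clear; lra.
Qed.

(** For a kernel vector [v], each coordinate of [v *m K] is 0 (in [Y]) or that of [v] (outside), so
    [v *m K] has squared norm [v K v^T], which forces [v = 0]. *)
Lemma det_dpp_mx_neq0 K Y :
  K^T = K -> (forall u : 'rV[R]_n, u != 0 -> 0 < bform K u u < bform 1%:M u u) ->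
  \det (dpp_mx K Y) != 0.
Proof.
move=> sK pK; rewrite -det_tr; apply/det0P => -[v v0 vM]; case/negP: v0; apply/eqP.
have vE i : if i \in Y then (v *m K) 0 i = 0 else (v *m K) 0 i = v 0 i.
  have := congr1 (fun w : 'rV[R]_n => w 0 i) vM; rewrite mxE [RHS]mxE.
  under eq_bigr do rewrite mxE mxE.
  have E : (v *m K) 0 i = \sum_j v 0 j * K i j.
    by rewrite mxE; apply: eq_bigr => j _; rewrite -{1}sK mxE.
  case: ifP => _; first by rewrite E.
  under eq_bigr do rewrite mxE mxE mulrDr.
  rewrite big_split /= (bigD1 i) //= eqxx mulr1 big1 ?addr0.
    by move/eqP; under eq_bigr do rewrite mxE mulrN; rewrite sumrN -E subr_eq0 => /eqP.
  by move=> j ji; rewrite eq_sym (negbTE ji) mulr0.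
apply: (strict_contraction_sqr sK pK).
rewrite bform1E /bform mxE; apply: eq_bigr => i _; rewrite [v^T _ _]mxE.
by have := vE i; case: ifP => _ ->; rewrite ?mul0r expr2 ?mul0r.
Qed.

(* The segment from 1/2 to K consists of strict contractions except possibly
   at K, so the determinant keeps its sign along it. *)
Lemma det_dpp_mx_ge0 K Y : psd_contraction K -> 0 <= \det (dpp_mx K Y).
Proof.
move=> cK; rewrite leNgt; apply/negP => dneg.
(* The segment is parametrised by the indeterminate, so the determinant along it is a polynomial and
   a sign change yields a root in [0, 1]. *)
pose Kp : 'M[{poly R}]_n := \matrix_(i, j)
  (((i == j)%:R * 2^-1)%:P * (1 - 'X) + (K i j)%:P * 'X).
pose Mp : 'M[{poly R}]_n := \matrix_(i, j)
  if i \in Y then Kp i j else ((i == j)%:R)%:P - Kp i j.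
pose Kt (t : R) : 'M[R]_n := (2^-1 * (1 - t))%:M + t *: K.
have detE t : (\det Mp).[t] = \det (dpp_mx (Kt t) Y).
  have -> : (\det Mp).[t] = horner_eval t (\det Mp) by [].
  rewrite -det_map_mx; congr (\det _); apply/matrixP => i j.
  rewrite !mxE /= /horner_eval; case: ifP => _;
  rewrite !(hornerD, hornerN, hornerM, hornerC, hornerX);
  by case: (i == j) => /=; ring.
have [pK qK] := cK.
have Kt_strict t : 0 <= t < 1 -> \det (dpp_mx (Kt t) Y) != 0.
  move=> t01; apply: det_dpp_mx_neq0.
    by rewrite linearD /= tr_scalar_mx linearZ /= pK.1.
  move=> u u0.
  have -> : bform (Kt t) u u = 2^-1 * (1 - t) * bform 1%:M u u + t * bform K u u.
    rewrite -bform_scalar /bform mulmxDr mulmxDl mxE; congr (_ + _).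
    by rewrite -scalemxAr -scalemxAl mxE.
  have u1 := bform1_gt0 u0.
  have := pK.2 u; have := qK.2 u; rewrite bformBm.
  move: (bform K u u) (bform 1%:M u u) u1 t01 => x y; clear; nra.
have Kt0 : 0 < (\det Mp).[0].
  rewrite detE (_ : dpp_mx _ _ = (2^-1)%:M); first by rewrite det_scalar exprn_gt0.
  apply/matrixP => i j; rewrite !mxE; case: ifP => _;
  by case: (i == j) => /=; rewrite ?mulr0n ?mulr1n; lra.
have Kt1 : (\det Mp).[1] < 0.
  rewrite detE (_ : Kt 1 = K)//; apply/matrixP => i j.
  by rewrite !mxE subrr mulr0 mul0rn mul1r add0r.
have [||t] := @poly_ivt R (- \det Mp) 0 1 => //.
  by rewrite !hornerN; lra.
rewrite rootN => /andP[t0 t1] /rootP rt.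
have [tE|tn] := eqVneq t 1; first by move: Kt1; rewrite -tE rt ltxx.
have := Kt_strict t; rewrite -detE rt eqxx t0 lt_neqAle tn t1 => /(_ isT).
by [].
Qed.

End DppMatrix.

(** * Tilting a kernel at one ground element *)

Section Tilt.
Context (R : realType) (n : nat) (x : 'I_n).
Implicit Types (K : 'M[R]_n) (Y : {set 'I_n}) (t : R).

(** The determinant of [1 - K + D^2 K]: the total mass once the sets containing [x] are reweighted
    by [t ^+ 2]. *)
Definition tilt_norm t K : R := 1 + (t ^+ 2 - 1) * K x x.

Definition tilt_coef t K : R := (t ^+ 2 - 1) / tilt_norm t K.

Definition tilt_diag t : 'rV[R]_n := \row_i (if i == x then t else 1).

(* With D = diag(1, .., t, .., 1), this is D K (1 - K + D^2 K)^-1 D, the inverse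
   being computed by the Sherman-Morrison formula; it corresponds to replacing
   the L-ensemble L = K (1 - K)^-1 by D L D, and thus multiplies the probability
   of every set containing x by t^2, up to normalisation. *)
Definition tilt t K : 'M[R]_n :=
  \matrix_(i, j) (tilt_diag t 0 i * tilt_diag t 0 j *
                  (K i j - tilt_coef t K * (K i x * K x j))).

(** It is the convex combination of 1 and [t ^+ 2] with weight [K x x]. *)
Lemma tilt_norm_gt0 t K : 0 < t -> psd_contraction K -> 0 < tilt_norm t K.
Proof.
move=> t0 cK; rewrite /tilt_norm; have := contraction_diag x cK.
have : 0 < t ^+ 2 by rewrite exprn_gt0.
move: (K x x) (t ^+ 2) => a s; clear; nra.
Qed.

Lemma tilt_coef_diag t K : tilt_norm t K != 0 ->
  1 - tilt_coef t K * K x x = (tilt_norm t K)^-1.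
Proof.
rewrite /tilt_coef => q0; apply: (mulIf q0); rewrite mulVf// mulrBl mul1r.
by rewrite mulrAC mulfVK//; rewrite /tilt_norm; ring.
Qed.

(** Absorbing the diagonal scaling into [w], the form is that of [K] at [w] minus [c] times the
    square of its pairing with the unit vector [e]; Cauchy-Schwarz and [c * K x x <= 1] bound the
    subtracted term. *)
Lemma tilt_psd t K : 0 < t -> psd_contraction K -> psd (tilt t K).
Proof.
move=> t0 cK; have [[sK pK] _] := cK; have q0 := tilt_norm_gt0 t0 cK.
have sKE i j : K i j = K j i by rewrite -{1}sK mxE.
split.
  apply/matrixP => i j; rewrite !mxE (sKE j i) (sKE j x) (sKE x i).
  by congr (_ * _); [rewrite mulrC|rewrite [K x j * _]mulrC].
move=> v; pose w : 'rV[R]_n := v *m diag_mx (tilt_diag t).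
have wE i : w 0 i = v 0 i * tilt_diag t 0 i by rewrite /w mul_mx_diag mxE.
pose e : 'rV[R]_n := delta_mx 0 x.
have weE : bform K w e = \sum_i w 0 i * K i x.
  by rewrite /bform trmx_delta -colE !mxE.
have -> : bform (tilt t K) v v = bform K w w - tilt_coef t K * bform K w e ^+ 2.
  rewrite weE expr2 mulr_suml mulr_sumr !bformE -sumrB.
  apply: eq_bigr => j _; rewrite mulr_suml mulr_sumr !mulr_sumr mulr_suml -sumrB.
  apply: eq_bigr => i _; rewrite !wE [tilt t K _ _]mxE (sKE x j); ring.
set c := tilt_coef t K.
have ca : c * K x x <= 1.
  by rewrite -subr_ge0 tilt_coef_diag ?invr_ge0 ?ltW// gt_eqF.
have := psd_cauchy_schwarz w e cK.1; rewrite [bform K e e]bform_delta.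
have := pK w; have := psd_diag_ge0 x cK.1.
move: (bform K w w) (bform K w e) (K x x) ca => A b a ca a0 A0 bA.
have [c0|c0] := leP c 0; first by have := sqr_ge0 b; nra.
have : c * b ^+ 2 <= c * (A * a) by rewrite ler_pM2l.
nra.
Qed.

(** Complementation exchanges [t] and [t^-1], so the upper bound on a tilted kernel reduces to
    [tilt_psd]. *)
Lemma tilt_opp t K : 0 < t -> psd_contraction K ->
  1%:M - tilt t K = tilt t^-1 (1%:M - K).
Proof.
move=> t0 cK; have q0 := tilt_norm_gt0 t0 cK.
have tn : t != 0 by rewrite gt_eqF.
have qE : tilt_norm t^-1 (1%:M - K) = tilt_norm t K / t ^+ 2.
  by rewrite /tilt_norm !mxE eqxx /=; field.
have cE : tilt_coef t^-1 (1%:M - K) = - tilt_coef t K.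
  by rewrite /tilt_coef qE; field; rewrite tn gt_eqF.
have q0' : 1 + (t ^+ 2 - 1) * K x x != 0 by rewrite gt_eqF.
apply/matrixP => i j; rewrite [RHS]mxE cE !mxE /tilt_coef /tilt_norm.
have [->|ix] := eqVneq i x; have [->|jx] := eqVneq j x; rewrite ?eqxx /=.
- by field; rewrite q0' tn.
- by field; rewrite q0' tn.
- by rewrite ?(negbTE ix) /=; field; rewrite q0' tn.
- by field.
Qed.

Lemma tilt_contraction t K : 0 < t -> psd_contraction K ->
  psd_contraction (tilt t K).
Proof.
move=> t0 cK; split; first exact: tilt_psd.
rewrite tilt_opp//; apply: tilt_psd; first by rewrite invr_gt0.
exact: contraction_opp.
Qed.

(** The tilted mixture is the old one times a rank-one update [B], between two diagonal matrices.
    [B] contributes the inverse norm, the diagonals the factor at [x]. *)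
Lemma det_dpp_mx_tilt t K Y : 0 < t -> psd_contraction K ->
  \det (dpp_mx (tilt t K) Y) =
  (if x \in Y then t ^+ 2 else 1) * \det (dpp_mx K Y) / tilt_norm t K.
Proof.
move=> t0 cK; have q0 := tilt_norm_gt0 t0 cK.
have tn : t != 0 by rewrite gt_eqF.
have q0' : 1 + (t ^+ 2 - 1) * K x x != 0 by rewrite gt_eqF.
set c := tilt_coef t K.
pose d : 'rV[R]_n := \row_i (if i == x then (if x \in Y then t else t^-1) else 1).
pose B : 'M[R]_n := 1%:M + delta_mx x 0 *m (- c *: row x K).
have BE i j : (dpp_mx K Y *m B) i j =
    dpp_mx K Y i j - c * (dpp_mx K Y i x * K x j).
  rewrite mulmxDr mulmx1 mulmxA -colE mxE; congr (_ + _).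
  by rewrite mxE big_ord1 !mxE; ring.
have DE (A : 'M[R]_n) i j : (diag_mx d *m A *m diag_mx (tilt_diag t)) i j =
    d 0 i * A i j * tilt_diag t 0 j.
  by rewrite mul_mx_diag mxE mul_diag_mx mxE.
have -> : dpp_mx (tilt t K) Y =
    diag_mx d *m (dpp_mx K Y *m B) *m diag_mx (tilt_diag t).
  apply/matrixP => i j; rewrite DE BE.
  rewrite !mxE /c /tilt_coef /tilt_norm.
  have [->|ix] := eqVneq i x; last first.
    case: (i \in Y); first ring.
    by case: (eqVneq j x) => [->|jx]; rewrite ?(negbTE ix)/=;
      [field|case: (i == j) => /=; field].
  case: (x \in Y); first by case: (j == x); field.
  have [->|jx] := eqVneq j x; first by rewrite ?eqxx /=; field; rewrite ?q0' ?tn.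
  by rewrite ?eqxx /=; field; rewrite ?q0' ?tn.
rewrite !det_mulmx !det_diag.
have -> : \det B = (tilt_norm t K)^-1.
  rewrite -tilt_coef_diag ?gt_eqF// /B det_add1_mulC -scalemxAl -colE.
  by rewrite det_mx11 !mxE eqxx -/c mulNr.
have -> : \prod_i d 0 i * (\det (dpp_mx K Y) / tilt_norm t K) *
    \prod_i tilt_diag t 0 i =
    (\prod_i (d 0 i * tilt_diag t 0 i)) * (\det (dpp_mx K Y) / tilt_norm t K).
  by rewrite big_split /=; ring.
rewrite -mulrA; congr (_ * _); rewrite (bigD1 x) //= !mxE eqxx big1 ?mulr1.
  by case: ifP => _; rewrite ?mulVf// expr2.
by move=> i ix; rewrite !mxE (negbTE ix) mulr1.
Qed.

End Tilt.

(* The inequality is an equality at s = 1, so the derivatives agree there. *)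
Lemma exp_tangency (R : realType) (c m : nat) (a : R) : 0 <= a <= 1 ->
  (forall s, 0 < s -> s ^+ c <= (1 + (s - 1) * a) ^+ m) -> c%:R = m%:R * a.
Proof.
move=> a01 H.
have ma0 : 0 <= m%:R * a by rewrite mulr_ge0 ?ler0n; lra.
(* Taking logarithms, with [ln (1 + h)] bounded below by [h / (1 + h)] and [ln (1 + h * a)] above by
   [a * h]. *)
have E h : -1 < h -> c%:R * (h / (1 + h)) <= m%:R * a * h.
  move=> h1; have h0 : 0 < 1 + h by lra.
  rewrite -ler_expR; apply: (@le_trans _ _ ((1 + h) ^+ c)).
    have hE : expR (h / (1 + h)) <= 1 + h.
      rewrite -(invrK (1 + h)) -(invrK (expR _)) lef_pV2 ?posrE ?invr_gt0 ?expR_gt0//.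
      rewrite -expRN invrK; apply: le_trans (expR_ge1Dx _).
      by rewrite le_eqVlt; apply/orP; left; apply/eqP; field; rewrite gt_eqF.
    by rewrite expRM_natl; apply: lerXn2r => //; rewrite nnegrE ?expR_ge0// ltW.
  apply: le_trans (H _ h0) _; rewrite -mulrA expRM_natl.
  have hE : 1 + (1 + h - 1) * a <= expR (a * h).
    by rewrite (le_trans _ (expR_ge1Dx _))// [1 + h - 1]addrC addKr mulrC.
  apply: lerXn2r => //; rewrite nnegrE ?expR_ge0//; move: a01 h0; clear; nra.
apply/eqP; rewrite eq_le; apply/andP; split.
- apply/ler_addgt0Pr => e e0; have b1 : 0 < m%:R * a + 1 by lra.
  (* Dividing [E] by [h] leaves the error [h * (m%:R * a)], which this choice keeps below [e]. *)
  pose h := e / (m%:R * a + 1).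
  have h0 : 0 < h by rewrite divr_gt0.
  have he : h * (m%:R * a + 1) = e by rewrite /h mulfVK// gt_eqF.
  have h1 : -1 < h by lra.
  move: (E h h1); rewrite mulrA ler_pdivrMr; last lra.
  rewrite mulrAC ler_pM2r// => le; nra.
- apply/ler_addgt0Pr => e e0; have b1 : 0 < m%:R * a + 1 + e by lra.
  (* The extra [e] in the denominator ensures [h < 1], so that [E] applies at [- h]. *)
  pose h := e / (m%:R * a + 1 + e).
  have h0 : 0 < h by rewrite divr_gt0.
  have he : h * (m%:R * a + 1 + e) = e by rewrite /h mulfVK// gt_eqF.
  have h1 : h < 1 by rewrite /h ltr_pdivrMr; lra.
  have h2 : -1 < - h by lra.
  move: (E (- h) h2); rewrite mulrA ler_pdivrMr; last lra.
  rewrite mulrAC ler_nM2r ?oppr_lt0// => le; nra.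
Qed.

(** * Existence of a maximum likelihood kernel and its diagonal *)

Section MaximumLikelihood.
Context (R : realType) (n : nat).
Implicit Types (K : 'M[R]_n) (s : seq {set 'I_n}).
Local Open Scope classical_set_scope.

(** Kept as a product, which stays real and continuous where a probability vanishes. *)
Definition likelihood s K : R := \prod_(A <- s) \det (dpp_mx K A).

(** Bounded because all entries have absolute value at most 1; closed as an intersection of
    preimages of closed sets under entries and quadratic forms. *)
Lemma compact_contractions :
  compact [set v : 'rV[R]_(n * n) | psd_contraction (vec_mx v)].
Proof.
have cvec i j : continuous (fun v : 'rV[R]_(n * n) => vec_mx v i j).
  by under eq_fun do rewrite mxE; apply: coord_continuous.
have cb u : continuous (fun v : 'rV[R]_(n * n) => bform (vec_mx v) u u).
  by apply: continuous_bform => // i; apply: cst_continuous.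
apply: bounded_closed_compact.
  apply: bounded_set_entries => v cv i.
  case/mxvec_indexP: i => i j.
  by have := contraction_norm_entry i j cv; rewrite mxE.
have -> : [set v : 'rV[R]_(n * n) | psd_contraction (vec_mx v)] =
    (\bigcap_(p in [set: 'I_n * 'I_n])
       (fun v => vec_mx v p.1 p.2 - vec_mx v p.2 p.1) @^-1` [set 0%R]) `&`
    \bigcap_(u in [set: 'rV[R]_n])
      ((fun v => bform (vec_mx v) u u) @^-1` [set r | 0 <= r] `&`
       (fun v => bform (vec_mx v) u u) @^-1` [set r | r <= bform 1%:M u u]).
  apply/seteqP; split=> v /=.
    move=> [[sK pK] [_ qK]]; split.
      by move=> [i j] _ /=; rewrite -{1}sK mxE subrr.
    move=> u _; split=> /=; first exact: pK.
    by have := qK u; rewrite bformBm subr_ge0.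
  move=> [sK pK].
  have sv : (vec_mx v)^T = vec_mx v.
    apply/matrixP => i j; rewrite [LHS]mxE; apply/eqP; rewrite -subr_eq0; apply/eqP.
    exact: (sK (j, i)).
  split; split=> //.
  - by move=> u; have [] := pK u I.
  - by rewrite linearB /= tr_scalar_mx sv.
  - by move=> u; have [_ /=] := pK u I; rewrite bformBm subr_ge0.
apply: closedI.
  apply: closed_bigI => -[i j] _.
  apply: preimage_closed; last exact: closed_eq.
  by move=> v _; exact: (cvgB (cvec i j v) (cvec j i v)).
apply: closed_bigI => u _; apply: closedI; apply: preimage_closed.
- by move=> v _; apply: cb.
- exact: closed_ge.
- by move=> v _; apply: cb.
- exact: closed_le.
Qed.

Lemma half_contraction : psd_contraction ((2^-1)%:M : 'M[R]_n).
Proof.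
split; split; rewrite ?linearB /= ?tr_scalar_mx// => v.
  by rewrite bform_scalar mulr_ge0 ?bform1_ge0.
by rewrite bformBm [X in _ - X]bform_scalar; have := bform1_ge0 v; lra.
Qed.

(** Half the identity makes all sets equally likely; hence the maximal likelihood is positive and
    can be cancelled. *)
Lemma likelihood_half_gt0 s : 0 < likelihood s (2^-1)%:M.
Proof.
apply: prodr_gt0 => A _; rewrite (_ : dpp_mx _ _ = (2^-1)%:M).
  by rewrite det_scalar exprn_gt0.
apply/matrixP => i j; rewrite !mxE; case: ifP => _ //.
by case: (i == j) => /=; rewrite ?mulr0n ?mulr1n; lra.
Qed.

Lemma exists_max_likelihood s : exists2 K, psd_contraction K &
  forall K', psd_contraction K' -> likelihood s K' <= likelihood s K.
Proof.
have [||v] := @EVT_max_rV R (n * n) (fun v => likelihood s (vec_mx v)) _ _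
  compact_contractions.
- by exists (mxvec (2^-1)%:M); rewrite /= mxvecK; apply: half_contraction.
- apply: continuous_subspaceT; apply: continuous_prodr => A _.
  apply: continuous_det => i j; case: (boolP (i \in A)) => iA.
    by under eq_fun do rewrite mxE iA mxE; apply: coord_continuous.
  under eq_fun do rewrite mxE (negbTE iA) !mxE.
  have c1 : continuous (fun _ : 'rV[R]_(n * n) => (i == j)%:R : R).
    exact: cst_continuous.
  have c2 := @coord_continuous R 1 (n * n) 0 (mxvec_index i j).
  by move=> v; exact: (cvgB (c1 v) (c2 v)).
rewrite inE => /= cv vmax; exists (vec_mx v) => // K' cK'.
by have := vmax (mxvec K'); rewrite mxvecK; apply; rewrite inE /= mxvecK.
Qed.

Lemma likelihood_tilt s (x : 'I_n) t K : 0 < t -> psd_contraction K ->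
  likelihood s (tilt x t K) =
  (t ^+ 2) ^+ count (fun A : {set 'I_n} => x \in A) s * likelihood s K /
  tilt_norm x t K ^+ size s.
Proof.
move=> t0 cK; have q0 := lt0r_neq0 (tilt_norm_gt0 x t0 cK).
rewrite /likelihood; elim: s => [|A s IH] /=.
  by rewrite !big_nil !expr0 mulr1 invr1 mulr1.
rewrite !big_cons IH det_dpp_mx_tilt// exprS.
by case: (x \in A); rewrite ?add0n ?add1n ?exprS; field; rewrite q0 expf_neq0.
Qed.

(* Tilting at x cannot increase the maximal likelihood: this is the inequality
   of [exp_tangency] with c the number of sample sets containing x. *)
Lemma max_likelihood_diag s K (x : 'I_n) : psd_contraction K ->
  (forall K', psd_contraction K' -> likelihood s K' <= likelihood s K) ->
  (count (fun A : {set 'I_n} => x \in A) s)%:R = (size s)%:R * K x x.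
Proof.
move=> cK Kmax; apply: exp_tangency; first exact: contraction_diag.
(* Tilting by a square root makes the factor [t ^+ 2] an arbitrary positive [r]. *)
move=> r r0; have t0 : 0 < Num.sqrt r by rewrite sqrtr_gt0.
have L0 : 0 < likelihood s K.
  exact: lt_le_trans (likelihood_half_gt0 s) (Kmax _ half_contraction).
have q0 := tilt_norm_gt0 x t0 cK.
have := Kmax _ (tilt_contraction x t0 cK).
rewrite likelihood_tilt// ler_pdivrMr ?exprn_gt0// mulrC ler_pM2l//.
by rewrite /tilt_norm sqr_sqrtr; last exact: ltW.
Qed.

End MaximumLikelihood.

(** * From determinants back to [dpp] and [loss] *)

Section DppLoss.
Context (R : realType) (X : finType).
Implicit Types (K : kernel R X) (S Y : {set X}).

Lemma marginal_kernelP K : marginal_kernel K <-> psd_contraction K.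
Proof.
split=> [[sK eK]|cK]; first exact: contraction_of_eigenvalues.
by split; [exact: cK.1.1|move=> a; apply: contraction_eigenvalue].
Qed.

Definition rank_set Y : {set 'I_#|X|} := enum_val @^-1: Y.

Lemma rank_set_bij : bijective rank_set.
Proof.
exists (fun Z : {set 'I_#|X|} => enum_rank @^-1: Z) => Y; apply/setP => i.
  by rewrite !finset.inE enum_rankK.
by rewrite !finset.inE enum_valK.
Qed.

Lemma subset_rank_set S Y : (rank_set S \subset rank_set Y) = (S \subset Y).
Proof.
apply/fintype.subsetP/fintype.subsetP => sub i; last by rewrite !finset.inE; apply: sub.
by have := sub (enum_rank i); rewrite !finset.inE enum_rankK.
Qed.

(** The determinants are nonnegative, have the required inclusion sums, and total 1 (the case of the
    empty [S]); uniqueness identifies them with [dpp]. *)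
Lemma dpp_det K Y : marginal_kernel K -> dpp K Y = \det (dpp_mx K (rank_set Y)).
Proof.
move=> /marginal_kernelP cK.
pose P : {ffun {set X} -> R} := [ffun Z => \det (dpp_mx K (rank_set Z))].
have PS S : \sum_(Z : {set X} | S \subset Z) P Z = \det (principal_submx K S).
  have -> : \sum_(Z : {set X} | S \subset Z) P Z =
      \sum_(Z : {set 'I_#|X|} | rank_set S \subset Z) \det (dpp_mx K Z).
    rewrite [RHS](reindex rank_set) /=; last exact/onW_bij/rank_set_bij.
    by apply: eq_big => Z; rewrite ?subset_rank_set// ffunE.
  rewrite sum_det_dpp_mx.
  apply: (@det_rows_principal _ _ K _ (fun i : 'I_#|S| => enum_rank (enum_val i))).
    by move=> i j /enum_rank_inj/enum_val_inj.
  move=> i; rewrite finset.inE; apply/idP/codomP => [iS|[k ->]].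
    exists (enum_rank_in iS (enum_val i)).
    by rewrite enum_rankK_in// enum_valK.
  by rewrite enum_rankK enum_valP.
rewrite (@dppE _ _ _ P) ?ffunE//; split=> //; split.
  by move=> Z; rewrite ffunE; apply: det_dpp_mx_ge0.
have := PS finset.set0; under eq_bigl do rewrite finset.sub0set.
by move=> ->; move: (principal_submx K _); rewrite cards0 => A; rewrite det_mx00.
Qed.

(** Zero factors are covered because a summand [-oo] absorbs the whole sum. *)
Lemma sum_lne (I : Type) (s : seq I) (P : I -> R) : (forall i, 0 <= P i) ->
  (\sum_(i <- s) lne (P i)%:E)%E = lne (\prod_(i <- s) P i)%:E.
Proof.
move=> P0; elim: s => [|i s IH]; first by rewrite !big_nil lne1.
rewrite !big_cons IH.
have [->|Pi] := eqVneq (P i) 0; first by rewrite mul0r [lne 0]le0_lneNy// addNye.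
have [->|Ps] := eqVneq (\prod_(j <- s) P j) 0.
  by rewrite mulr0 [lne 0]le0_lneNy// addeNy.
rewrite EFinM lneM// in_itv /= ?leey andbT lte_fin lt_neqAle eq_sym ?Pi ?Ps ?P0//.
by rewrite prodr_ge0.
Qed.

Lemma loss_likelihood (s : seq {set X}) K : marginal_kernel K ->
  loss s K = (- (((size s)%:R^-1)%:E *
    lne (likelihood [seq rank_set A | A <- s] K)%:E))%E.
Proof.
move=> mK; rewrite /loss /likelihood big_map -sum_lne.
  by congr (- (_ * _))%E; apply: eq_bigr => A _; rewrite dpp_det.
by move=> A; apply: det_dpp_mx_ge0; apply/marginal_kernelP.
Qed.

Lemma exists_loss_le_diag (s : seq {set X}) K : marginal_kernel K ->
  exists2 K' : kernel R X, marginal_kernel K' /\ (loss s K' <= loss s K)%E &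
    forall x, entry K' x x =
      (count (fun A : {set X} => x \in A) s)%:R / (size s)%:R.
Proof.
(* For an empty sample division by 0 yields 0, so the zero kernel has the required diagonal. *)
move=> mK; have [s0|s0] := eqVneq (size s) 0.
  have m0 : marginal_kernel (0 : kernel R X).
    apply/marginal_kernelP; split; split; rewrite ?subr0 ?trmx0 ?tr_scalar_mx// => v.
      by rewrite /bform mulmx0 mul0mx mxE.
    exact: bform1_ge0.
  exists 0; last by move=> x; rewrite /entry mxE s0 invr0 mulr0.
  by split => //; rewrite (size0nil s0) /loss !big_nil.
have [K' cK' K'max] := @exists_max_likelihood R _ [seq rank_set A | A <- s].
have mK' : marginal_kernel K' by apply/marginal_kernelP.
exists K'.
  split=> //; rewrite !loss_likelihood// leeN2 lee_pmul2l//; last first.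
    by rewrite lte_fin invr_gt0 ltr0n lt0n.
  have cK : psd_contraction K by apply/marginal_kernelP.
  rewrite lee_lne ?in_itv /= ?leey ?andbT ?lee_fin; first exact: K'max.
    by apply: prodr_ge0 => A _; apply: det_dpp_mx_ge0.
  by apply: prodr_ge0 => A _; apply: det_dpp_mx_ge0.
move=> x; have := max_likelihood_diag (enum_rank x) cK' K'max.
rewrite count_map size_map /entry => cE.
have -> : count (fun A : {set X} => x \in A) s =
    count (preim rank_set (fun A : {set 'I_#|X|} => enum_rank x \in A)) s.
  by apply: eq_count => A /=; rewrite finset.inE enum_rankK.
by rewrite cE mulrC mulKf// pnatr_eq0.
Qed.

End DppLoss.

(** * Counting memberships in the edge sample *)

Section EdgeSample.
Context (V : finType) (G : sgraph V).

Lemma size_edge_sample : size (edge_sample G) = #|edge G|.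
Proof. by rewrite size_map -cardE. Qed.

Lemma count_edge_sample (x : ground G) :
  count (fun A : {set ground G} => x \in A) (edge_sample G) =
  #|[pred e : edge G | x \in edge_set e]|.
Proof. by rewrite count_map -size_filter cardE enumT; congr size. Qed.

Lemma count_edge_sample_edge (e : edge G) :
  count (fun A : {set ground G} => inr e \in A) (edge_sample G) = 1%N.
Proof.
rewrite count_edge_sample -(card1 e); apply: eq_card => e' /=.
by rewrite !finset.inE eq_sym.
Qed.

(** Sending [w] to [[set u; w]] matches neighbours of [u] with edges at [u]; it is injective because
    there are no loops. *)
Lemma count_edge_sample_vertex (u : V) :
  count (fun A : {set ground G} => inl u \in A) (edge_sample G) = deg G u.
Proof.
have eP w : w \in [set w | G u w]%SET -> is_edge G [set u; w]%SET.
  by rewrite finset.inE => uw; apply/existsP; exists u;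
    apply/existsP; exists w; rewrite uw eqxx.
rewrite count_edge_sample /deg -(card_imset _ val_inj).
have inj : {in [set w | G u w]%SET &, injective (fun w => [set u; w]%SET)}.
  move=> w w'; rewrite !finset.inE => uw uw' /setP/(_ w).
  rewrite !finset.inE eqxx orbT => /esym/orP[/eqP wu|/eqP//].
  by move: uw; rewrite wu (adj_irrefl G).
rewrite -(card_in_imset inj); apply: eq_card => e.
apply/imsetP/imsetP => [[f]|[w wu ->]].
  rewrite !finset.inE /=; case: f => f fe /= uf ->.
  have /existsP[a /existsP[b /andP[ab /eqP fE]]] := fe.
  move: uf; rewrite fE !finset.inE => /orP[/eqP ua|/eqP ub].
    by exists b; rewrite ?finset.inE ?ua.
  by exists a; rewrite ?finset.inE ?ub 1?finset.setUC// (adj_sym G).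
by exists (exist (fun e => is_edge G e) _ (eP w wu)) => //;
  rewrite !finset.inE /= ?finset.inE ?eqxx.
Qed.

End EdgeSample.

Theorem theorem2p6 (R : realType) (n M k d : nat)
    (phi : cnf3 n M) (phi_occ : occurs_at_most k phi)
    (H : sgraph (litcopy n k)) (H_reg : regular H d)
    (sigma : 'I_M -> 'I_3 -> 'I_k) (sigma_ok : valid_choice phi sigma)
    (G := bot_graph phi sigma H) (m := #|edge G|)
    (K : kernel R (ground G)) (K_marg : marginal_kernel K) :
  exists K' : kernel R (ground G),
    [/\ marginal_kernel K',
        (loss (edge_sample G) K' <= loss (edge_sample G) K)%E,
        forall u : bot_vertex M H, entry K' (inl u) (inl u) = (deg G u)%:R / m%:R
      & forall e : edge G, entry K' (inr e) (inr e) = 1 / m%:R].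
Proof.
have [K' [mK' lK'] dK'] := exists_loss_le_diag (edge_sample G) K_marg.
exists K'; split=> // [u|e]; rewrite dK' size_edge_sample.
  by rewrite count_edge_sample_vertex.
by rewrite count_edge_sample_edge.
Qed.
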